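(* Let $V$ be an $n$-dimensional real inner-product vector space and let $Cl(V)$ denote its associated Clifford algebra. Let $p\ge 2$ be an integer, let $\vec x_0,\vec c\in V$, and let $\vec n\in V$ be a unit vector, i.e. $\vec n\diamond\vec n=1$. Consider the iteration $$\vec x_{k+1}=(\vec x_k\diamond\vec n)^p\diamond\vec n+\vec c,\qquad k\ge 0.$$ Then the mapping $f(\vec x)=(\vec x\diamond\vec n)^p\diamond\vec n+\vec c$ is well-defined as a function $f:V\to V$. Moreover, every iterate $\vec x_k$ lies in the grade-$1$ subspace $\langle Cl(V)\rangle_1=V$, so the entire orbit $(\vec x_k)_{k\ge 0}$ is contained in $V$.
   Context: $Cl(V)$ is the real Clifford (geometric) algebra of the inner-product space $V$: the associative unital real algebra generated by $V$ subject to $\vec v\diamond\vec v=\vec v\cdot\vec v$ for $\vec v\in V$, where $\cdot$ is the inner product. $\diamond$ denotes the product of $Cl(V)$ (the geometric product); for vectors $\vec a,\vec b\in V$ it decomposes as $\vec a\diamond\vec b=\vec a\cdot\vec b+\vec a\wedge\vec b$, with $\wedge$ the outer (exterior) product. $V$ is identified with its image in $Cl(V)$, which is the grade-$1$ subspace $\langle Cl(V)\rangle_1$. Powers are taken with respect to $\diamond$. The integer $n=\dim V$ and the vector $\vec n$ are unrelated. *)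

(* Defs.v *)
From HB Require Import structures.
From mathcomp Require Import all_boot all_order all_algebra.
From mathcomp Require Import boolp classical_sets reals.

Set Implicit Arguments.
Unset Strict Implicit.
Unset Printing Implicit Defensive.

Import Order.TTheory GRing.Theory Num.Theory.
Local Open Scope ring_scope.
Local Open Scope quotient_scope.

(** The Clifford algebra of a finite-dimensional real inner-product space
    [(V, dot)], given by its presentation: noncommutative polynomial expressions
    in the elements of [V] with real coefficients, modulo the least congruence
    that contains the laws of unital associative algebras, the linearity of the
    generators, and [v * v = dot v v].  The canonical map [cl_gen : V -> Cl dot]
    identifies [V] with its image [range (cl_gen dot)]. *)

Inductive clterm (R V : Type) : Type :=
| ClGen of V
| ClCst of R
| ClAdd of clterm R V & clterm R V
| ClMul of clterm R V & clterm R V.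
Arguments ClGen {R V}.
Arguments ClCst {R V}.

HB.instance Definition _ (R V : Type) := gen_eqMixin (clterm R V).
HB.instance Definition _ (R V : Type) := gen_choiceMixin (clterm R V).

Section Presentation.
Variables (R : realType) (V : vectType R) (dot : {dot V for idfun}).

Inductive clrel : clterm R V -> clterm R V -> Prop :=
| clrel_refl s : clrel s s
| clrel_sym s t : clrel s t -> clrel t s
| clrel_trans s t u : clrel s t -> clrel t u -> clrel s u
| clrel_add s s' t t' :
    clrel s s' -> clrel t t' -> clrel (ClAdd s t) (ClAdd s' t')
| clrel_mul s s' t t' :
    clrel s s' -> clrel t t' -> clrel (ClMul s t) (ClMul s' t')
| clrel_addA s t u : clrel (ClAdd s (ClAdd t u)) (ClAdd (ClAdd s t) u)
| clrel_addC s t : clrel (ClAdd s t) (ClAdd t s)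
| clrel_add0 s : clrel (ClAdd (ClCst 0) s) s
| clrel_addN s : clrel (ClAdd (ClMul (ClCst (-1)) s) s) (ClCst 0)
| clrel_mulA s t u : clrel (ClMul s (ClMul t u)) (ClMul (ClMul s t) u)
| clrel_mul1l s : clrel (ClMul (ClCst 1) s) s
| clrel_mul1r s : clrel (ClMul s (ClCst 1)) s
| clrel_mulDl s t u :
    clrel (ClMul (ClAdd s t) u) (ClAdd (ClMul s u) (ClMul t u))
| clrel_mulDr s t u :
    clrel (ClMul s (ClAdd t u)) (ClAdd (ClMul s t) (ClMul s u))
| clrel_cstD a b : clrel (ClCst (a + b)) (ClAdd (ClCst a) (ClCst b))
| clrel_cstM a b : clrel (ClCst (a * b)) (ClMul (ClCst a) (ClCst b))
| clrel_cstC a s : clrel (ClMul (ClCst a) s) (ClMul s (ClCst a))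
| clrel_genP a u v :
    clrel (ClGen (a *: u + v)) (ClAdd (ClMul (ClCst a) (ClGen u)) (ClGen v))
| clrel_sqr v : clrel (ClMul (ClGen v) (ClGen v)) (ClCst (dot v v)).

Definition clequiv (s t : clterm R V) : bool := `[< clrel s t >].

Lemma clequiv_refl : reflexive clequiv.
Proof. by move=> s; apply/asboolP; exact: clrel_refl. Qed.

Lemma clequiv_sym : symmetric clequiv.
Proof.
by move=> s t; apply/idP/idP => /asboolP st; apply/asboolP; exact: clrel_sym.
Qed.

Lemma clequiv_trans : transitive clequiv.
Proof.
move=> t s u /asboolP st /asboolP tu; apply/asboolP.
exact: clrel_trans st tu.
Qed.

Canonical clequiv_equiv :=
  EquivRel clequiv clequiv_refl clequiv_sym clequiv_trans.

Definition Cl : Type := {eq_quot clequiv}.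
HB.instance Definition _ := Choice.on Cl.
HB.instance Definition _ := EqQuotient.on Cl.

Definition clpi (s : clterm R V) : Cl := \pi_Cl s.

Lemma clpiP s t : clpi s = clpi t <-> clrel s t.
Proof.
split=> [/eqmodP /asboolP //|st].
by apply/eqmodP; apply/asboolP.
Qed.

Lemma clpi_repr (x : Cl) : clpi (repr x) = x.
Proof. exact: reprK. Qed.

Lemma clrel_repr s : clrel (repr (clpi s)) s.
Proof. by apply/clpiP; rewrite clpi_repr. Qed.

Lemma cl_ind (P : Cl -> Prop) : (forall s, P (clpi s)) -> forall x, P x.
Proof. by move=> Ppi x; rewrite -(clpi_repr x). Qed.

Definition cl_add (x y : Cl) : Cl := clpi (ClAdd (repr x) (repr y)).
Definition cl_mul (x y : Cl) : Cl := clpi (ClMul (repr x) (repr y)).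
Definition cl_cst (a : R) : Cl := clpi (ClCst a).
Definition cl_opp (x : Cl) : Cl := cl_mul (cl_cst (-1)) x.
Definition cl_scale (a : R) (x : Cl) : Cl := cl_mul (cl_cst a) x.

Lemma cl_addE s t : cl_add (clpi s) (clpi t) = clpi (ClAdd s t).
Proof. by apply/clpiP; apply: clrel_add; exact: clrel_repr. Qed.

Lemma cl_mulE s t : cl_mul (clpi s) (clpi t) = clpi (ClMul s t).
Proof. by apply/clpiP; apply: clrel_mul; exact: clrel_repr. Qed.

Let clE := (cl_addE, cl_mulE).

Lemma cl_addA : associative cl_add.
Proof.
elim/cl_ind=> s; elim/cl_ind=> t; elim/cl_ind=> u; rewrite !clE.
by apply/clpiP; constructor.
Qed.

Lemma cl_addC : commutative cl_add.
Proof.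
by elim/cl_ind=> s; elim/cl_ind=> t; rewrite !clE; apply/clpiP; constructor.
Qed.

Lemma cl_add0 : left_id (cl_cst 0) cl_add.
Proof. by elim/cl_ind=> s; rewrite !clE; apply/clpiP; constructor. Qed.

Lemma cl_addN : left_inverse (cl_cst 0) cl_opp cl_add.
Proof.
elim/cl_ind=> s; rewrite /cl_opp /cl_cst cl_mulE cl_addE.
by apply/clpiP; constructor.
Qed.

HB.instance Definition _ :=
  GRing.isZmodule.Build Cl cl_addA cl_addC cl_add0 cl_addN.

Lemma cl_mulA : associative cl_mul.
Proof.
elim/cl_ind=> s; elim/cl_ind=> t; elim/cl_ind=> u; rewrite !clE.
by apply/clpiP; constructor.
Qed.

Lemma cl_mul1l : left_id (cl_cst 1) cl_mul.
Proof. by elim/cl_ind=> s; rewrite !clE; apply/clpiP; constructor. Qed.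

Lemma cl_mul1r : right_id (cl_cst 1) cl_mul.
Proof. by elim/cl_ind=> s; rewrite !clE; apply/clpiP; constructor. Qed.

Lemma cl_mulDl : left_distributive cl_mul cl_add.
Proof.
elim/cl_ind=> s; elim/cl_ind=> t; elim/cl_ind=> u; rewrite !clE.
by apply/clpiP; constructor.
Qed.

Lemma cl_mulDr : right_distributive cl_mul cl_add.
Proof.
elim/cl_ind=> s; elim/cl_ind=> t; elim/cl_ind=> u; rewrite !clE.
by apply/clpiP; constructor.
Qed.

Lemma cl_cstD a b : cl_cst (a + b) = cl_add (cl_cst a) (cl_cst b).
Proof. by rewrite !clE; apply/clpiP; constructor. Qed.

Lemma cl_cstM a b : cl_cst (a * b) = cl_mul (cl_cst a) (cl_cst b).
Proof. by rewrite !clE; apply/clpiP; constructor. Qed.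

Lemma cl_cstC a x : cl_mul (cl_cst a) x = cl_mul x (cl_cst a).
Proof. by elim/cl_ind: x => s; rewrite !clE; apply/clpiP; constructor. Qed.

Definition cl_gen (v : V) : Cl := clpi (ClGen v).

(** Evaluation of expressions along a Clifford map into an algebra [B]. *)

Section Eval.
Variables (B : algType R) (f : {linear V -> B}).

Fixpoint cleval (s : clterm R V) : B :=
  match s with
  | ClGen v => f v
  | ClCst a => a%:A
  | ClAdd s t => cleval s + cleval t
  | ClMul s t => cleval s * cleval t
  end.

Hypothesis f_sqr : forall v, f v * f v = (dot v v)%:A.

Lemma cleval_rel s t : clrel s t -> cleval s = cleval t.
Proof.
elim=> //= {s t}.
- by move=> s t u _ -> _ ->.
- by move=> s s' t t' _ -> _ ->.
- by move=> s s' t t' _ -> _ ->.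
- by move=> s t u; rewrite addrA.
- by move=> s t; rewrite addrC.
- by move=> s; rewrite scale0r add0r.
- by move=> s; rewrite scaleN1r mulN1r addNr scale0r.
- by move=> s t u; rewrite mulrA.
- by move=> s; rewrite scale1r mul1r.
- by move=> s; rewrite scale1r mulr1.
- by move=> s t u; rewrite mulrDl.
- by move=> s t u; rewrite mulrDr.
- by move=> a b; rewrite scalerDl.
- by move=> a b; rewrite -scalerAl mul1r scalerA.
- by move=> a s; rewrite -scalerAl -scalerAr mul1r mulr1.
- by move=> a u v; rewrite linearP -scalerAl mul1r.
Qed.

End Eval.

(** A matrix representation, built one orthogonal direction at a time; it shows
    that the presentation does not collapse. *)

Lemma clrep_sub (k : nat) (U : {vspace V}) : (\dim U <= k)%N ->
  exists m : nat, exists f : {linear V -> 'M[R]_m.+1},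
    forall v, v \in U -> f v * f v = (dot v v)%:A.
Proof.
elim: k U => [|k IH] U dimU.
  exists 0%N, \0 => v; move: dimU; rewrite leqn0 dimv_eq0 => /eqP ->.
  by rewrite memv0 => /eqP ->; rewrite /= linear0r scale0r mul0r.
have [U0|U_neq0] := eqVneq U 0%VS.
  by apply: IH; rewrite U0 dimv0.
pose u := vpick U; pose a := dot u u.
have uU : u \in U by exact: memv_pick.
have a_gt0 : 0 < a by rewrite neq0_dnorm_gt0// vpick0.
have l_lin : linear (fun v => dot v u : R^o).
  by move=> b v w; rewrite linearPl.
pose lL := GRing.isLinear.Build R V R^o *:%R _ l_lin.
pose l : {linear V -> R^o} := HB.pack (fun v => dot v u : R^o) lL.
have lE v : l v = dot v u by [].
pose W := (U :&: lker (linfun l))%VS.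
have WP v : (v \in W) = (v \in U) && (dot v u == 0).
  by rewrite memv_cap memv_ker lfunE.
have dimW : (\dim W <= k)%N.
  rewrite -ltnS; apply: leq_trans dimU; rewrite ltn_neqAle dimvS ?capvSl// andbT.
  apply: contraTN uU => /eqP dimWU.
  have WU : W = U by apply/eqP; rewrite eqEdim capvSl dimWU leqnn.
  by rewrite -WU WP negb_and (gt_eqF a_gt0) orbT.
have [m [f fP]] := IH W dimW.
pose P v := v - (dot v u / a) *: u.
have P_lin : linear P.
  move=> b v w; rewrite /P linearPl scalerBr scalerA /= mulrDl scalerDl opprD.
  by rewrite addrACA mulrA.
have PW v : v \in U -> P v \in W.
  move=> vU; rewrite WP memvB ?memvZ//=.
  by rewrite linearBl linearZl_LR /= -/a divfK ?(gt_eqF a_gt0)// subrr.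
pose g v : 'M[R]_(m.+1 + m.+1) :=
  block_mx (f (P v)) (dot v u / a)%:M (dot v u)%:M (- f (P v)).
have g_lin : linear g.
  move=> b v w; rewrite /g scale_block_mx add_block_mx P_lin !linearPl /=.
  rewrite linearP opprD scalerN -!raddfD /= mulrDl.
  by rewrite !scale_scalar_mx -!raddfD mulrA.
pose gL := GRing.isLinear.Build R V 'M[R]_(m.+1 + m.+1) *:%R _ g_lin.
pose G : {linear V -> 'M[R]_((m + m.+1).+1)} := HB.pack g gL.
exists (m + m.+1)%N, G => v vU.
have dotP : dot (P v) (P v) = dot v v - dot v u / a * dot v u.
  have PvW : dot (P v) u = 0 by have := PW v vU; rewrite WP => /andP[_ /eqP].
  have dotC : dot u v = dot v u by rewrite hermC expr0 mul1r.
  rewrite {2}/P linearBr linearZr_LR /= PvW mulr0 subr0.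
  by rewrite /P linearBl linearZl_LR /= dotC.
have fPv : f (P v) *m f (P v) = (dot (P v) (P v))%:M.
  by rewrite -scalemx1; exact: fP (PW v vU).
rewrite -[G v * G v]/(g v *m g v) /g mulmx_block !(mulmxN, mulNmx) opprK.
rewrite !mul_scalar_mx !mul_mx_scalar !subrr.
rewrite !scale_scalar_mx fPv dotP -!raddfD /= subrK.
rewrite [dot v u * _]mulrC addrC subrK.
by rewrite -scalar_mx_block mulr1.
Qed.

Lemma clrep : exists m : nat, exists f : {linear V -> 'M[R]_m.+1},
  forall v, f v * f v = (dot v v)%:A.
Proof.
have [m [f fP]] := clrep_sub (leqnn (\dim {:V})).
by exists m, f => v; apply: fP; rewrite memvf.
Qed.

Lemma cl_1_neq0 : cl_cst 1 != 0 :> Cl.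
Proof.
have [m [f fP]] := clrep; apply/eqP => /clpiP /(cleval_rel fP) /= /eqP.
by rewrite scale1r scale0r oner_eq0.
Qed.

HB.instance Definition _ := GRing.Zmodule_isNzRing.Build Cl
  cl_mulA cl_mul1l cl_mul1r cl_mulDl cl_mulDr cl_1_neq0.

Lemma cl_scaleA a b x : cl_scale a (cl_scale b x) = cl_scale (a * b) x.
Proof. by rewrite /cl_scale cl_cstM cl_mulA. Qed.

Lemma cl_scale1 : left_id 1 cl_scale.
Proof. exact: cl_mul1l. Qed.

Lemma cl_scaleDr : right_distributive cl_scale +%R.
Proof. by move=> a x y; exact: cl_mulDr. Qed.

Lemma cl_scaleDl x : {morph cl_scale^~ x : a b / a + b}.
Proof. by move=> a b; rewrite /cl_scale cl_cstD cl_mulDl. Qed.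

HB.instance Definition _ := GRing.Zmodule_isLmodule.Build R Cl
  cl_scaleA cl_scale1 cl_scaleDr cl_scaleDl.

Lemma cl_scaleAl (a : R) (x y : Cl) : a *: (x * y) = (a *: x) * y.
Proof. exact: cl_mulA. Qed.

HB.instance Definition _ := GRing.Lmodule_isLalgebra.Build R Cl cl_scaleAl.

Lemma cl_scaleAr (a : R) (x y : Cl) : a *: (x * y) = x * (a *: y).
Proof.
rewrite -[LHS]/(cl_mul (cl_cst a) (cl_mul x y)).
rewrite -[RHS]/(cl_mul x (cl_mul (cl_cst a) y)).
by rewrite !cl_mulA (cl_cstC a x).
Qed.

HB.instance Definition _ := GRing.Lalgebra_isAlgebra.Build R Cl cl_scaleAr.

Lemma cl_gen_linear : linear cl_gen.
Proof.
move=> a u v; rewrite -[RHS]/(cl_add (cl_mul (cl_cst a) (cl_gen u)) (cl_gen v)).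
rewrite /cl_gen /cl_cst !clE.
by apply/clpiP; constructor.
Qed.

HB.instance Definition _ :=
  GRing.isLinear.Build R V Cl *:%R cl_gen cl_gen_linear.

Lemma cl_gen_sqr v : cl_gen v * cl_gen v = (dot v v)%:A.
Proof.
rewrite -[LHS]/(cl_mul (cl_gen v) (cl_gen v)).
rewrite -[RHS]/(cl_mul (cl_cst (dot v v)) (cl_cst 1)) cl_mul1r /cl_gen clE.
by apply/clpiP; constructor.
Qed.

Lemma Cl_universal (B : algType R) (f : {linear V -> B}) :
  (forall v, f v * f v = (dot v v)%:A) ->
  exists g : {lrmorphism Cl -> B}, (forall v, g (cl_gen v) = f v) /\
    forall h : {lrmorphism Cl -> B}, (forall v, h (cl_gen v) = f v) -> h =1 g.
Proof.
move=> f_sqr; pose g (x : Cl) : B := cleval f (repr x).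
have gE s : g (clpi s) = cleval f s.
  by apply: cleval_rel => //; exact: clrel_repr.
have cstE a : cl_cst a = a%:A by rewrite -[LHS]cl_mul1r.
have g_lin : linear g.
  move=> a; elim/cl_ind=> s; elim/cl_ind=> t.
  rewrite -[a *: _ + _]/(cl_add (cl_mul (cl_cst a) (clpi s)) (clpi t)).
  by rewrite /cl_cst cl_mulE cl_addE !gE /= -scalerAl mul1r.
have g_mul : monoid_morphism g.
  split; first by rewrite -[1]/(clpi (ClCst 1)) gE /= scale1r.
  elim/cl_ind=> s; elim/cl_ind=> t.
  by rewrite -[clpi s * _]/(cl_mul (clpi s) (clpi t)) cl_mulE !gE.
pose gL := GRing.isLinear.Build R Cl B *:%R _ g_lin.
pose gM := GRing.isMonoidMorphism.Build Cl B _ g_mul.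
pose G : {lrmorphism Cl -> B} := HB.pack g gL gM.
exists G; split=> [v|h hE]; first exact: gE.
elim/cl_ind=> s; rewrite -[G _]/(g _) gE.
elim: s => [v|a|s IHs t IHt|s IHs t IHt] /=.
- exact: hE.
- by rewrite -[clpi _]/(cl_cst a) cstE linearZ_LR rmorph1.
- rewrite -cl_addE -[cl_add _ _]/(clpi s + clpi t).
  by rewrite rmorphD; congr (_ + _).
- rewrite -cl_mulE -[cl_mul _ _]/(clpi s * clpi t).
  by rewrite rmorphM; congr (_ * _).
Qed.

(** The grade-[k] subspace: linear combinations of products of [k] pairwise
    orthogonal vectors. *)
Definition cl_grade (k : nat) : set Cl :=
  [set z | exists m (a : 'I_m -> R) (b : 'I_m -> k.-tuple V),
     (forall i, pairwise (fun u v => dot u v == 0) (b i)) /\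
     z = \sum_(i < m) a i *: \prod_(v <- b i) cl_gen v]%classic.

End Presentation.

Arguments Cl {R V} dot.
Arguments cl_gen {R V} dot v.
Arguments cl_grade {R V} dot k.

(* Main.v *)
Require Import Defs.
From mathcomp Require Import all_boot all_order all_algebra.
From mathcomp Require Import boolp classical_sets reals.

Import Order.TTheory GRing.Theory Num.Theory.
Local Open Scope ring_scope.

(** Write [y_p = (x * e) ^+ p * e] for vectors [x] and [e] with [e * e = 1].
    Polarizing the relation [v * v = dot v v] gives
    [x * e + e * x = 2 * dot x e], so moving the middle [e] of [x * e * x * e]
    past [x] shows that [x * e] satisfies the quadratic equation
    [(x * e) ^+ 2 = 2 * dot x e *: (x * e) - dot x x].  Multiplying it by
    [(x * e) ^+ p * e] turns it into the two-term recurrence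
    [y_(p + 2) = 2 * dot x e *: y_(p + 1) - dot x x *: y_p] with real
    coefficients.  It starts from the two vectors [y_0 = e] and
    [y_1 = x * e * e = x], so every [y_p] is a vector: this is
    [cl_gen_powerP].

    Hence the right-hand side of the iteration maps the image of [V] in the
    Clifford algebra into itself.  That it defines a single function [V -> V]
    also requires that [V] embeds in the algebra, which is [cl_gen_inj]; the
    claim on orbits is then an induction. *)

Section CliffordVectors.
Variables (R : realType) (V : vectType R) (dot : {dot V for idfun}).
Local Notation g := (cl_gen dot).

(** A vector in the kernel squares to [0] in an algebra where [1 != 0], so it
    has norm [0], and the inner product is definite. *)
Lemma cl_gen_inj : injective g.
Proof.
move=> u v guv; apply/eqP; rewrite -subr_eq0; set w := u - v.
have gw0 : g w = 0 by rewrite /w linearB /= guv subrr.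
have /esym/eqP := cl_gen_sqr dot w.
rewrite gw0 mul0r scaler_eq0 oner_eq0 orbF => dw0.
by apply: contraTT dw0 => w_neq0; rewrite gt_eqF ?neq0_dnorm_gt0.
Qed.

(** Polarization of [cl_gen_sqr]. *)
Lemma cl_gen_anticomm u v : g u * g v + g v * g u = (dot u v *+ 2)%:A.
Proof.
have dotC : dot v u = dot u v by rewrite hermC expr0 mul1r.
have := cl_gen_sqr dot (u + v).
rewrite linearD /= mulrDl !mulrDr !cl_gen_sqr linearDl /= !linearDr /= dotC.
by rewrite !scalerDl -!addrA => /addrI; rewrite !addrA => /addIr ->.
Qed.

(** The quadratic equation of [g x * g e]: by anticommutation,
    [x e x e = x (2 (x . e) - x e) e], and both [x x] and [e e] are scalars. *)
Lemma cl_gen_mul_sqr x e : g e * g e = 1 ->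
  (g x * g e) ^+ 2 = (dot x e *+ 2) *: (g x * g e) - (dot x x)%:A.
Proof.
move=> ee1; have ex : g e * g x = (dot x e *+ 2)%:A - g x * g e.
  by rewrite -cl_gen_anticomm addrAC subrr add0r.
rewrite expr2 mulrA -(mulrA (g x)) ex mulrBr mulrBl -scalerAr mulr1 -scalerAl.
by congr (_ - _); rewrite -!mulrA ee1 mulr1 cl_gen_sqr.
Qed.

(** The induction carries two consecutive exponents, as the recurrence has
    order two. *)
Lemma cl_gen_powerP x e p : g e * g e = 1 ->
  exists y, g y = (g x * g e) ^+ p * g e.
Proof.
move=> ee1.
suff [] : (exists y, g y = (g x * g e) ^+ p * g e) /\
          (exists y, g y = (g x * g e) ^+ p.+1 * g e) by [].
elim: p => [|p [[y yE] [z zE]]].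
  split; first by exists e; rewrite mul1r.
  by exists x; rewrite expr1 -mulrA ee1 mulr1.
split; first by exists z.
exists ((dot x e *+ 2) *: z - dot x x *: y).
have -> : g ((dot x e *+ 2) *: z - dot x x *: y) =
    (dot x e *+ 2) *: g z - dot x x *: g y by rewrite linearB 2!linearZ_LR.
rewrite -[p.+2]/(2 + p)%N exprD cl_gen_mul_sqr// zE yE exprS.
by rewrite !mulrBl mulr_algl -!scalerAl.
Qed.

Lemma cl_gen_grade1 v : cl_grade dot 1 (g v).
Proof.
exists 1%N, (fun=> 1), (fun=> [tuple v]); split=> //.
by rewrite big_ord1 scale1r big_seq1.
Qed.

End CliffordVectors.

Theorem corollary1 (R : realType) (n : nat) (V : vectType R)
    (dot : {dot V for idfun}) (dimV : \dim {:V} = n)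
    (p : nat) (p_ge2 : (2 <= p)%N)
    (x0 c nv : V) (nv_unit : cl_gen dot nv * cl_gen dot nv = 1) :
  (exists! f : V -> V, forall x : V,
     cl_gen dot (f x) =
       (cl_gen dot x * cl_gen dot nv) ^+ p * cl_gen dot nv + cl_gen dot c) /\
  (forall X : nat -> Cl dot,
     X 0%N = cl_gen dot x0 ->
     (forall k, X k.+1 =
        (X k * cl_gen dot nv) ^+ p * cl_gen dot nv + cl_gen dot c) ->
     forall k, cl_grade dot 1 (X k) /\ range (cl_gen dot) (X k)).
Proof.
have /choice[f fE] x : exists y, cl_gen dot y =
    (cl_gen dot x * cl_gen dot nv) ^+ p * cl_gen dot nv + cl_gen dot c.
  have [y yE] := cl_gen_powerP _ _ dot x nv p nv_unit.
  by exists (y + c); rewrite linearD /= yE.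
split.
  exists f; split=> // f' f'E; apply/funext => x.
  by apply: (@cl_gen_inj _ _ dot); rewrite fE f'E.
move=> X X0 XS k.
have [v ->] : exists v, X k = cl_gen dot v.
  elim: k => [|k [v Xk]]; first by exists x0.
  by exists (f v); rewrite XS Xk fE.
by split; [exact: cl_gen_grade1 | exists v].
Qed.
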